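(* Let $N$ be a simply connected two-step nilpotent Lie group of dimension five with a left invariant Riemannian metric $g$, whose Lie algebra has three-dimensional center. Let $F$ be a left invariant Randers metric of Berwald type on $N$ with underlying Riemannian metric $g$. Then the flag curvature of $F$ and the sectional curvature of $g$ have the same sign: for every two-dimensional subspace $P\subset T_eN$ ($e$ the unit element of $N$) and every nonzero $A\in P$, the flag curvature $K(P,A)$ of $F$ is positive, zero or negative if and only if the sectional curvature of $g$ for the plane $P$ is positive, zero or negative, respectively.
   Context: A Lie group is two-step nilpotent if its Lie algebra $\mathfrak{n}$ is non-abelian and $[\mathfrak{n},[\mathfrak{n},\mathfrak{n}]]=0$. The Randers metric defined by a Riemannian metric $g$ and a vector field $X$ with $\sqrt{g(X,X)}<1$ is $F(x,Y)=\sqrt{g(x)(Y,Y)}+g(x)(X(x),Y)$. It is of Berwald type if and only if $X$ is parallel for the Levi-Civita connection of $g$ (this may be taken as the definition), and in that case the Chern connection of $F$ coincides with the Levi-Civita connection of $g$. A Finsler metric $F$ on a Lie group $G$ is left invariant if $F(a,Y)=F(e,T_a l_{a^{-1}}Y)$ for all $a\in G$, $Y\in T_aG$, where $l_{a^{-1}}$ is left translation by $a^{-1}$. The flag curvature of $F$ for a plane $P=\mathrm{span}\{U,Y\}$ and flagpole $Y\neq0$ is $$K(P,Y)=\frac{g_Y(R(U,Y)Y,U)}{g_Y(Y,Y)\,g_Y(U,U)-g_Y^2(Y,U)},$$ where $g_Y(U,V)=\frac12\frac{\partial^2}{\partial s\,\partial t}F^2(Y+sU+tV)\big|_{s=t=0}$,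 $R(U,Y)Y=\nabla_U\nabla_YY-\nabla_Y\nabla_UY-\nabla_{[U,Y]}Y$, and $\nabla$ is the Chern connection of $F$. *)

(* Defs.v *)
From HB Require Import structures.
From mathcomp Require Import all_boot all_order all_algebra.
From mathcomp Require Import ring.
From mathcomp Require Import all_classical all_reals all_analysis.

Set Implicit Arguments.
Unset Strict Implicit.
Unset Printing Implicit Defensive.

Import Order.TTheory GRing.Theory Num.Theory.
Import numFieldNormedType.Exports.

Local Open Scope classical_set_scope.
Local Open Scope ring_scope.

#[short(type="topGroupType")]
HB.structure Definition TopGroup := {G of Group G & Topological G}.

(* [U] is meant to be open and [V] finite dimensional: then differentiability
   together with [Ck k] directional derivatives is the usual C^(k+1). *)
Fixpoint Ck (R : realType) (V : normedModType R) (U : set V) (k : nat)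
    (f : V -> R) : Prop :=
  if k is k'.+1 then
    (forall x, U x -> differentiable f x) /\
    (forall v, Ck U k' (fun x => 'D_v f x))
  else forall x, U x -> {for x, continuous f}.

Definition smooth_on (R : realType) (V : normedModType R) (U : set V)
    (f : V -> R) : Prop := forall k, Ck U k f.

Section SmoothOnTheory.
Variables (R : realType) (V : normedModType R).

Lemma near_eq_differentiable (f g : V -> R) (x : V) :
  (\forall y \near x, f y = g y) -> differentiable f x -> differentiable g x.
Proof.
move=> fg df; have -> : g = f + (g - f) by rewrite addrC subrK.
apply: differentiableD => //.
set h : V -> R := g - f; apply/diffP.
have h0 : \forall y \near x, h y = 0.
  by apply: filterS fg => y fgy; rewrite /h !fctE fgy subrr.
have ho : h = cst 0 +o_x (center x).
  apply/eqaddoP => e e0; near=> y.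
  by rewrite !fctE (near h0 y)// subrr normr0 mulr_ge0// ltW.
apply: (@getPex _ (fun (df : {linear V -> R}) => continuous df /\
  forall y, h y = h (lim (nbhs x)) + df (y - lim (nbhs x))
                  +o_(y \near x) (y - lim (nbhs x)))).
exists (\0 : {linear V -> R}); split; first by move=> y; exact: cvg_cst.
apply: eqaddoEx => y; rewrite lim_id// (nbhs_singleton h0) addr0.
by rewrite {1}ho.
Unshelve. all: by end_near. Qed.

Variable U : set V.
Hypothesis oU : open U.

Let near_ext (f g : V -> R) : (forall x, U x -> f x = g x) ->
  forall x, U x -> \forall y \near x, f y = g y.
Proof.
move=> fg x Ux; apply: filterS (open_nbhs_nbhs (conj oU Ux)) => y.
exact: fg.
Qed.

Lemma Ck_ext k (f g : V -> R) :
  (forall x, U x -> f x = g x) -> Ck U k f -> Ck U k g.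
Proof.
elim: k f g => [|k IH] f g fg /=.
  move=> cf x Ux; have cfx : f y @[y --> x] --> f x := cf x Ux.
  suff : g y @[y --> x] --> f x by rewrite (fg x Ux).
  by apply: cvg_trans cfx; apply: near_eq_cvg; exact: near_ext Ux.
move=> [df Df]; split=> [x Ux|v].
  exact: near_eq_differentiable (near_ext fg Ux) (df x Ux).
by apply: IH (Df v) => x Ux; apply: near_eq_derive; exact: near_ext Ux.
Qed.

Lemma CkW k (f : V -> R) : Ck U k.+1 f -> Ck U k f.
Proof.
elim: k f => [|k IH] f [df Df].
  by move=> x Ux; apply: differentiable_continuous; exact: df.
by split=> // v; apply: IH; exact: Df.
Qed.

Lemma Ck_cst k (c : R) : Ck U k (cst c).
Proof.
elim: k c => [|k IH] c; first by move=> x _; exact: cvg_cst.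
split=> [x _|v]; first exact: differentiable_cst.
by apply: Ck_ext (IH 0) => x _; rewrite derive_cst.
Qed.

Lemma CkD k (f g : V -> R) : Ck U k f -> Ck U k g -> Ck U k (f + g).
Proof.
elim: k f g => [|k IH] f g.
  by move=> cf cg x Ux; apply: cvgD; [exact: cf|exact: cg].
move=> [df Df] [dg Dg]; split=> [x Ux|v].
  by apply: differentiableD; [exact: df|exact: dg].
apply: Ck_ext (IH _ _ (Df v) (Dg v)) => x Ux.
by rewrite deriveD//; apply: diff_derivable; [exact: df|exact: dg].
Qed.

Lemma CkM k (f g : V -> R) : Ck U k f -> Ck U k g -> Ck U k (f * g).
Proof.
elim: k f g => [|k IH] f g.
  by move=> cf cg x Ux; apply: cvgM; [exact: cf|exact: cg].
move=> Cf Cg; have [df Df] := Cf; have [dg Dg] := Cg; split=> [x Ux|v].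
  by apply: differentiableM; [exact: df|exact: dg].
have := CkD (IH _ _ (CkW Cf) (Dg v)) (IH _ _ (CkW Cg) (Df v)).
apply: Ck_ext => x Ux; rewrite deriveM//; apply: diff_derivable.
  exact: df.
exact: dg.
Qed.

End SmoothOnTheory.

Record chart (R : realType) (n : nat) (M : topologicalType) := Chart {
  chart_dom : set M;
  chart_fun : M -> 'rV[R]_n;
  chart_inv : 'rV[R]_n -> M }.

Definition chart_img R n M (c : @chart R n M) : set 'rV[R]_n :=
  chart_fun c @` chart_dom c.

Definition is_chart R n M (c : @chart R n M) : Prop :=
  [/\ open (chart_dom c), open (chart_img c),
      {in chart_dom c, cancel (chart_fun c) (chart_inv c)},
      {in chart_dom c, continuous (chart_fun c)} &
      {in chart_img c, continuous (chart_inv c)}].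

Record smooth_manifold (R : realType) (n : nat) (M : topologicalType) :=
  SmoothManifold {
    atlas : set (chart R n M);
    manifold_hausdorff : hausdorff_space M;
    manifold_second_countable : @second_countable M;
    atlas_chart : forall c, atlas c -> is_chart c;
    atlas_cover : forall x, exists2 c, atlas c & chart_dom c x;
    atlas_compat : forall c d, atlas c -> atlas d -> forall i,
      smooth_on [set x | chart_img c x /\ chart_dom d (chart_inv c x)]
                (fun x => chart_fun d (chart_inv c x) ord0 i) }.

Section Manifold.
Variables (R : realType) (n : nat) (M : topologicalType).
Variable S : smooth_manifold R n M.

Definition smooth_fun (f : M -> R) : Prop :=
  forall c, atlas S c -> smooth_on (chart_img c) (f \o chart_inv c).

Definition smooth_pred : {pred M -> R^o} := fun f => `[< smooth_fun f >].

Fact chart_img_open c : atlas S c -> open (chart_img c).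
Proof. by case/atlas_chart. Qed.

Fact smooth_subring_closed : subring_closed smooth_pred.
Proof.
have sM : {in smooth_pred &, forall f g, f * g \in smooth_pred}.
  move=> f g /asboolP sf /asboolP sg; apply/asboolP => c cS k.
  by apply: CkM; [exact: chart_img_open|exact: sf|exact: sg].
have sC a : (cst a : M -> R^o) \in smooth_pred.
  by apply/asboolP => c cS k; apply: Ck_cst; exact: chart_img_open.
split=> // [|f g fS /asboolP sg]; first exact: sC.
have /asboolP sNg : cst (-1) * g \in smooth_pred by apply: sM => //; exact/asboolP.
move/asboolP: fS => sf; apply/asboolP => c cS k.
have -> : f - g = f + cst (-1) * g.
  by apply/funext => x; rewrite !fctE mulN1r.
by apply: CkD; [exact: chart_img_open|exact: sf|exact: sNg].
Qed.

HB.instance Definition _ :=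
  GRing.isSubringClosed.Build (M -> R^o) smooth_pred smooth_subring_closed.

Fact smooth_scaler_closed : scaler_closed smooth_pred.
Proof.
move=> a f fS; have -> : a *: f = cst a * f by [].
apply: rpredM => //; apply/asboolP => c cS k.
by apply: Ck_cst; exact: chart_img_open.
Qed.

HB.instance Definition _ :=
  GRing.isScaleClosed.Build R (M -> R^o) smooth_pred smooth_scaler_closed.

(* The ring and [R]-module C^oo(M). *)
Record Cinf := MkCinf { Cinf_val :> M -> R^o; _ : Cinf_val \in smooth_pred }.

HB.instance Definition _ := [isSub for Cinf_val].
HB.instance Definition _ := [Choice of Cinf by <:].
HB.instance Definition _ := GRing.SubChoice_isSubComPzRing.Build
  (M -> R^o) smooth_pred Cinf (subringClosedP _).
HB.instance Definition _ := [SubZmodule_isSubLmodule of Cinf by <:].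

Lemma Cinf_ext (f h : Cinf) : (forall x, f x = h x) -> f = h.
Proof. by move=> fh; apply/val_inj/funext. Qed.
Lemma CinfD (f h : Cinf) x : (f + h) x = f x + h x. Proof. by []. Qed.
Lemma CinfN (f : Cinf) x : (- f) x = - f x. Proof. by []. Qed.
Lemma CinfM (f h : Cinf) x : (f * h) x = f x * h x. Proof. by []. Qed.
Lemma CinfZ (a : R) (f : Cinf) x : (a *: f) x = a * f x. Proof. by []. Qed.
Definition CinfE := (CinfD, CinfN, CinfM, CinfZ).

(* Tangent vectors at [p] are the derivations of C^oo(M) at [p]. *)
Definition tangent_pred (p : M) : {pred Cinf -> R^o} := fun v =>
  `[< (forall (a : R) (f h : Cinf), v (a *: f + h) = a * v f + v h) /\
      (forall f h : Cinf, v (f * h) = f p * v h + h p * v f) >].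

Fact tangent_submod_closed p : submod_closed (tangent_pred p).
Proof.
have z f : (0 : Cinf -> R^o) f = 0 by [].
split=> [|a u v /asboolP[lu Lu] /asboolP[lv Lv]]; apply/asboolP.
  by split=> [b f h|f h]; rewrite !z ?mulr0 ?addr0.
have e f : (a *: u + v) f = a * u f + v f by [].
by split=> [b f h|f h]; rewrite !e ?lu ?lv ?Lu ?Lv; ring.
Qed.

HB.instance Definition _ p := GRing.isSubmodClosed.Build R (Cinf -> R^o)
  (tangent_pred p) (tangent_submod_closed p).

Record tangent (p : M) :=
  Tangent { tangent_val :> Cinf -> R^o; _ : tangent_val \in tangent_pred p }.

HB.instance Definition _ p := [isSub for @tangent_val p].
HB.instance Definition _ p := [Choice of tangent p by <:].
HB.instance Definition _ p := [SubChoice_isSubLmodule of tangent p by <:].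

(* [w] is the image of [v] under the differential of [phi]; for smooth [phi]
   every pullback [h] below exists. *)
Definition pushforward (phi : M -> M) (p q : M) (v : tangent p)
    (w : tangent q) : Prop :=
  phi p = q /\
  forall f h : Cinf, (forall x, h x = f (phi x)) -> w f = v h.

(* Vector fields are the derivations of the algebra C^oo(M). *)
Definition vfield_pred : {pred Cinf -> Cinf} := fun X =>
  `[< (forall (a : R) (f h : Cinf), X (a *: f + h) = a *: X f + X h) /\
      (forall f h : Cinf, X (f * h) = f * X h + h * X f) >].

Fact vfield_submod_closed : submod_closed vfield_pred.
Proof.
have z f : (0 : Cinf -> Cinf) f = 0 by [].
split=> [|a X Y /asboolP[lX LX] /asboolP[lY LY]]; apply/asboolP.
  by split=> [b f h|f h]; rewrite !z ?mulr0 ?scaler0 ?addr0.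
have e f : (a *: X + Y) f = a *: X f + Y f by [].
by split=> [b f h|f h]; rewrite !e ?lX ?lY ?LX ?LY;
  apply/Cinf_ext => x; rewrite !CinfE; ring.
Qed.

HB.instance Definition _ := GRing.isSubmodClosed.Build R (Cinf -> Cinf)
  vfield_pred vfield_submod_closed.

Record vfield :=
  Vfield { vfield_val :> Cinf -> Cinf; _ : vfield_val \in vfield_pred }.

HB.instance Definition _ := [isSub for vfield_val].
HB.instance Definition _ := [Choice of vfield by <:].
HB.instance Definition _ := [SubChoice_isSubLmodule of vfield by <:].

Fact vfield_at_subproof (X : vfield) (p : M) :
  ((fun f => X f p) : Cinf -> R^o) \in tangent_pred p.
Proof.
have /asboolP[lX LX] : vfield_val X \in vfield_pred := valP X.
by apply/asboolP; split=> [a f h|f h]; rewrite ?lX ?LX.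
Qed.

Definition vfield_at (X : vfield) (p : M) : tangent p :=
  Tangent (vfield_at_subproof X p).

Fact fscale_subproof (f : Cinf) (X : vfield) :
  (fun h => f * X h) \in vfield_pred.
Proof.
have /asboolP[lX LX] : vfield_val X \in vfield_pred := valP X.
apply/asboolP; split=> [a h k|h k]; rewrite ?lX ?LX.
  by apply/Cinf_ext => x; rewrite !CinfE; ring.
ring.
Qed.

Definition fscale (f : Cinf) (X : vfield) : vfield :=
  Vfield (fscale_subproof f X).

Fact lie_bracket_subproof (X Y : vfield) :
  (fun f => X (Y f) - Y (X f)) \in vfield_pred.
Proof.
have /asboolP[lX LX] : vfield_val X \in vfield_pred := valP X.
have /asboolP[lY LY] : vfield_val Y \in vfield_pred := valP Y.
have aX f h : X (f + h) = X f + X h by rewrite -[f]scale1r lX !scale1r.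
have aY f h : Y (f + h) = Y f + Y h by rewrite -[f]scale1r lY !scale1r.
apply/asboolP; split=> [a f h|f h].
  by rewrite !(lX, lY); apply/Cinf_ext => x; rewrite !CinfE; ring.
by rewrite !(LX, LY, aX, aY); ring.
Qed.

Definition lie_bracket (X Y : vfield) : vfield :=
  Vfield (lie_bracket_subproof X Y).


Record riemannian_metric := RiemannianMetric {
  metric_val :> forall p : M, tangent p -> tangent p -> R;
  metric_linear : forall p (a : R) (u v w : tangent p),
    metric_val (a *: u + v) w = a * metric_val u w + metric_val v w;
  metric_sym : forall p (u v : tangent p), metric_val u v = metric_val v u;
  metric_pos : forall p (u : tangent p), u != 0 -> 0 < metric_val u u;
  metric_smooth : forall X Y : vfield,
    (fun p => metric_val (vfield_at X p) (vfield_at Y p)) \in smooth_pred }.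

Definition metric_fun (g : riemannian_metric) (X Y : vfield) : Cinf :=
  MkCinf (metric_smooth g X Y).

Definition affine_connection (D : vfield -> vfield -> vfield) : Prop :=
  [/\ forall f X Y Z, D (fscale f X + Y) Z = fscale f (D X Z) + D Y Z,
      forall X Y Z : vfield, D X (Y + Z) = D X Y + D X Z &
      forall (X : vfield) f Y, D X (fscale f Y) = fscale (X f) Y + fscale f (D X Y)].

Definition torsion_free (D : vfield -> vfield -> vfield) : Prop :=
  forall X Y, D X Y - D Y X = lie_bracket X Y.

Definition levi_civita (g : riemannian_metric)
    (D : vfield -> vfield -> vfield) : Prop :=
  [/\ affine_connection D, torsion_free D &
      forall X Y Z : vfield,
        X (metric_fun g Y Z) = metric_fun g (D X Y) Z + metric_fun g Y (D X Z)].

Definition parallel (D : vfield -> vfield -> vfield) (X : vfield) : Prop :=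
  forall Y, D Y X = 0.

Definition curvature (D : vfield -> vfield -> vfield) (X Y Z : vfield) :
    vfield :=
  D X (D Y Z) - D Y (D X Z) - D (lie_bracket X Y) Z.

(* The sectional curvature at [p] of the plane spanned by the values of [U]
   and [Y]; it depends on that plane only. *)
Definition sectional_curvature (g : riemannian_metric)
    (D : vfield -> vfield -> vfield) (p : M) (U Y : vfield) : R :=
  let u := vfield_at U p in let y := vfield_at Y p in
  g p (vfield_at (curvature D U Y Y) p) u / (g p y y * g p u u - g p y u ^+ 2).

Definition randers (g : riemannian_metric) (X : vfield) (p : M)
    (y : tangent p) : R :=
  Num.sqrt (g p y y) + g p (vfield_at X p) y.

Section Finsler.
Variable F : forall p : M, tangent p -> R.

(* g_y(u, v) *)
Definition fundamental_tensor (p : M) (y u v : tangent p) : R :=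
  2^-1 * derive1 (fun s : R =>
    derive1 (fun t : R => F (y + s *: u + t *: v) ^+ 2) 0) 0.

(* C_y(u, v, w) *)
Definition cartan_tensor (p : M) (y u v w : tangent p) : R :=
  2^-1 * derive1 (fun r : R => fundamental_tensor (y + r *: u) v w) 0.

Definition nowhere_zero (V : vfield) : Prop := forall p, vfield_at V p != 0.

(* The Chern connection, as the family of affine connections [D V] indexed by
   the reference vector fields [V]: [D V] is torsion free and almost compatible
   with g_V. The function [h] is g_V(Y, Z), which is smooth. *)
Definition chern_connection (D : vfield -> vfield -> vfield -> vfield) : Prop :=
  forall V, nowhere_zero V ->
  [/\ affine_connection (D V), torsion_free (D V) &
      forall (X Y Z : vfield) (h : Cinf),
        (forall p, h p = fundamental_tensor (vfield_at V p) (vfield_at Y p)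
                                            (vfield_at Z p)) ->
        forall p, X h p =
          fundamental_tensor (vfield_at V p) (vfield_at (D V X Y) p)
                             (vfield_at Z p) +
          fundamental_tensor (vfield_at V p) (vfield_at Y p)
                             (vfield_at (D V X Z) p) +
          2 * cartan_tensor (vfield_at V p) (vfield_at (D V X V) p)
                            (vfield_at Y p) (vfield_at Z p)].

(* The flag curvature at [p] with flagpole the value of [Y] and plane spanned
   by the values of [U] and [Y]; the reference field is [Y]. When [F] is of
   Berwald type this depends only on the plane and on the flagpole. *)
Definition flag_curvature (D : vfield -> vfield -> vfield -> vfield) (p : M)
    (U Y : vfield) : R :=
  let u := vfield_at U p in let y := vfield_at Y p in
  let gy := fundamental_tensor y in
  gy (vfield_at (curvature (D Y) U Y Y) p) u / (gy y y * gy u u - gy y u ^+ 2).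

End Finsler.
End Manifold.

Definition has_dim (R : pzRingType) (V : lmodType R) (A : set V) (d : nat) :
    Prop :=
  exists b : 'I_d -> V,
    (forall c : 'I_d -> R, \sum_i c i *: b i = 0 -> forall i, c i = 0) /\
    A = [set \sum_i c i *: b i | c in [set: 'I_d -> R]].

Definition simply_connected (R : realType) (M : topologicalType) : Prop :=
  (forall x y : M, exists gamma : R -> M,
     [/\ {within `[0, 1], continuous gamma}, gamma 0 = x & gamma 1 = y]) /\
  (forall gamma : R -> M,
     {within `[0, 1], continuous gamma} -> gamma 0 = gamma 1 ->
     exists H : R * R -> M,
       {within `[0, 1] `*` `[0, 1], continuous H} /\
       forall t, t \in `[0, 1] ->
         [/\ H (0, t) = gamma t, H (1, t) = gamma 0,
             H (t, 0) = gamma 0 & H (t, 1) = gamma 0]).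

Section LieGroup.
Variables (R : realType) (n : nat) (G : topGroupType).
Variable S : smooth_manifold R n G.

Definition lie_group : Prop :=
  [/\ continuous (fun z : G * G => (z.1 * z.2)%g),
      continuous (fun x : G => x^-1%g),
      forall c d e, atlas S c -> atlas S d -> atlas S e -> forall i,
        smooth_on
          [set z : 'rV[R]_n * 'rV[R]_n | [/\ chart_img c z.1, chart_img d z.2 &
             chart_dom e (chart_inv c z.1 * chart_inv d z.2)%g]]
          (fun z => chart_fun e (chart_inv c z.1 * chart_inv d z.2)%g ord0 i) &
      forall c d, atlas S c -> atlas S d -> forall i,
        smooth_on
          [set x | chart_img c x /\ chart_dom d (chart_inv c x)^-1%g]
          (fun x => chart_fun d (chart_inv c x)^-1%g ord0 i)].

Definition left_invariant_vfield (X : vfield S) : Prop :=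
  forall a p : G,
    pushforward (fun x => (a * x)%g) (vfield_at X p) (vfield_at X (a * p)%g).

Definition lie_algebra : set (vfield S) := [set X | left_invariant_vfield X].

Definition lie_center : set (vfield S) :=
  [set Z | lie_algebra Z /\ forall X, lie_algebra X -> lie_bracket Z X = 0].

Definition two_step_nilpotent : Prop :=
  (exists X Y, [/\ lie_algebra X, lie_algebra Y & lie_bracket X Y != 0]) /\
  (forall X Y Z, lie_algebra X -> lie_algebra Y -> lie_algebra Z ->
     lie_bracket X (lie_bracket Y Z) = 0).

Definition left_invariant_metric (g : riemannian_metric S) : Prop :=
  forall (a : G) (u v : tangent S a) (u0 v0 : tangent S 1%g),
    pushforward (fun x => (a^-1 * x)%g) u u0 ->
    pushforward (fun x => (a^-1 * x)%g) v v0 ->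
    g a u v = g 1%g u0 v0.

Definition left_invariant_finsler (F : forall p : G, tangent S p -> R) : Prop :=
  forall (a : G) (y : tangent S a) (y0 : tangent S 1%g),
    pushforward (fun x => (a^-1 * x)%g) y y0 -> F a y = F 1%g y0.

End LieGroup.

Arguments lie_algebra {R n G} S.
Arguments lie_center {R n G} S.
Arguments lie_group {R n G} S.
Arguments two_step_nilpotent {R n G} S.

(* Main.v *)
Require Import Defs.
From mathcomp Require Import all_boot all_order all_algebra.
From mathcomp Require Import ring lra.
From mathcomp Require Import all_classical all_reals all_analysis.

Set Implicit Arguments.
Unset Strict Implicit.
Unset Printing Implicit Defensive.

Import Order.TTheory GRing.Theory Num.Theory.
Import numFieldNormedType.Exports.

Local Open Scope classical_set_scope.
Local Open Scope ring_scope.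

(** Write alpha for the norm of g, beta for the 1-form g(X, .), and
    F = alpha + beta.  The theorem holds because of the identity

      K(P, y) = (alpha(y) / F(y))^2 * (sectional curvature of P),

    in which the factor is positive ([flag_curvature_randers]).  It rests on
    three facts.

    - Since X is parallel, the Levi-Civita connection of g satisfies the
      equations of the Chern connection of F: alpha(V), g(V, Y) and beta(Y)
      are differentiated along W by moving the derivative onto the vector
      fields, so W(g_V(Y, Z)) is computed by the chain rule, and the terms
      containing nabla_W V add up to the Cartan tensor
      ([levi_civita_almost_metric]).  Those equations have at most one
      solution ([almost_metric_difference_eq0]), so the Chern connection is
      the Levi-Civita connection and both curvatures come from the same
      vector r = R(U, Y)Y.

    - The vector r is orthogonal to y, by skew-symmetry of the curvature, and
      to X, because R(., .)X = 0.  In g_y(r, u) every term with a factor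
      g(r, y) or beta(r) therefore drops out, which leaves
      (F / alpha) g(r, u).

    - The Gram determinant of (y, u) for g_y is (F / alpha)^3 times the one
      for g, because g_y(y, v) = F dF_y(v).  Dividing gives the factor
      (alpha / F)^2 ([flag_ratio]), also for a degenerate plane, where both
      quotients are 0.

    The first point needs g_V(Y, Z) to be a smooth function, hence that
    1 / alpha(V) is smooth when V vanishes nowhere ([Ck_inv_sqrt]). *)

(** * The Minkowski norm of a Randers metric on one tangent space *)

Lemma is_derive1D (R : realType) (f g : R -> R) (x df dg : R) :
  is_derive x 1 f df -> is_derive x 1 g dg ->
  is_derive x 1 (fun t => f t + g t) (df + dg).
Proof. exact: is_deriveD. Qed.

Lemma is_derive1B (R : realType) (f g : R -> R) (x df dg : R) :
  is_derive x 1 f df -> is_derive x 1 g dg ->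
  is_derive x 1 (fun t => f t - g t) (df - dg).
Proof. exact: is_deriveB. Qed.

Lemma is_derive1M (R : realType) (f g : R -> R) (x df dg : R) :
  is_derive x 1 f df -> is_derive x 1 g dg ->
  is_derive x 1 (fun t => f t * g t) (f x * dg + g x * df).
Proof. exact: is_deriveM. Qed.

Record inner_product (R : realType) (V : lmodType R) (dot : V -> V -> R) :
    Prop := InnerProduct {
  inner_linear : forall (a : R) u v w, dot (a *: u + v) w = a * dot u w + dot v w;
  inner_sym : forall u v, dot u v = dot v u;
  inner_pos : forall u : V, u != 0 -> 0 < dot u u }.

Section MinkowskiNorm.
Variables (R : realType) (V : lmodType R) (dot : V -> V -> R).
Hypothesis dotP : inner_product dot.
Variable b : V.
Implicit Types u v w y z : V.

Let dot_linear := inner_linear dotP.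
Let dot_sym := inner_sym dotP.
Let dot_pos := inner_pos dotP.

Definition alpha (y : V) : R := Num.sqrt (dot y y).

(** All derivatives below are polynomial in [rho], [dot] and [alpha], which
    keeps the identities between them within reach of ring normalization. *)
Definition rho (y : V) : R := (alpha y)^-1.
Definition rnorm (y : V) : R := alpha y + dot b y.
Definition drnorm (y v : V) : R := dot y v * rho y + dot b v.

(** The Hessian of [alpha], which is also that of [rnorm]. *)
Definition hess (y u v : V) : R :=
  dot u v * rho y - dot y u * dot y v * rho y ^+ 3.
Definition dhess (y w u v : V) : R :=
  3 * (dot y u * dot y v * dot y w * rho y ^+ 5)
  - (dot y w * dot u v + dot y v * dot w u + dot y u * dot w v) * rho y ^+ 3.

(** The fundamental tensor g_y(u, v), half the Hessian of [rnorm ^+ 2]. *)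
Definition gten (y u v : V) : R :=
  rnorm y * hess y u v + drnorm y u * drnorm y v.

(** The Cartan tensor C_y(w, u, v), half the derivative of [gten] along [w]. *)
Definition cten (y w u v : V) : R :=
  2^-1 * (drnorm y w * hess y u v + drnorm y u * hess y w v
          + drnorm y v * hess y w u + rnorm y * dhess y w u v).

Lemma dotDl u v w : dot (u + v) w = dot u w + dot v w.
Proof. by rewrite -[u]scale1r dot_linear mul1r scale1r. Qed.

Lemma dotZl a u w : dot (a *: u) w = a * dot u w.
Proof.
have d0 : dot 0 w = 0 by move: (dotDl 0 0 w); rewrite addr0; lra.
by rewrite -[a *: u]addr0 dot_linear d0 addr0.
Qed.

Lemma dotDr u v w : dot w (u + v) = dot w u + dot w v.
Proof. by rewrite dot_sym dotDl !(dot_sym w). Qed.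

Lemma dotZr a u w : dot w (a *: u) = a * dot w u.
Proof. by rewrite dot_sym dotZl (dot_sym w). Qed.

Lemma dotNl u w : dot (- u) w = - dot u w.
Proof. by rewrite -scaleN1r dotZl mulN1r. Qed.

Lemma dotNr u w : dot w (- u) = - dot w u.
Proof. by rewrite dot_sym dotNl dot_sym. Qed.

Lemma dot_ge0 u : 0 <= dot u u.
Proof.
have [->|/dot_pos/ltW//] := eqVneq u 0.
by rewrite -(scale0r u) dotZl mul0r.
Qed.

Lemma alpha_gt0 y : y != 0 -> 0 < alpha y.
Proof. by move=> y0; rewrite sqrtr_gt0 dot_pos. Qed.

Lemma sqr_alpha y : alpha y ^+ 2 = dot y y.
Proof. by rewrite sqr_sqrtr// dot_ge0. Qed.

Lemma alphaV y : y != 0 -> alpha y * rho y = 1.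
Proof. by move=> y0; rewrite divff// gt_eqF// alpha_gt0. Qed.

Lemma lineZ0 (z w : V) : z + (0 : R) *: w = z.
Proof. by rewrite scale0r addr0. Qed.

Lemma is_derive_dotl z w u :
  is_derive (0 : R) 1 (fun t : R => dot (z + t *: w) u) (dot w u).
Proof.
under eq_fun do rewrite dotDl dotZl.
apply: (is_derive_eq (is_derive1D (is_derive_cst _ _ _)
  (is_derive1M (is_derive_id _ _) (is_derive_cst (dot w u) _ _)))).
by rewrite /cst/=; ring.
Qed.

Lemma is_derive_dotr z w u :
  is_derive (0 : R) 1 (fun t : R => dot u (z + t *: w)) (dot u w).
Proof.
rewrite (dot_sym u w).
by under eq_fun do rewrite dot_sym; exact: is_derive_dotl.
Qed.

Lemma is_derive_normsq z w :
  is_derive (0 : R) 1 (fun t : R => dot (z + t *: w) (z + t *: w))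
    (2 * dot z w).
Proof.
under eq_fun do rewrite dotDr dotZr.
apply: (is_derive_eq (is_derive1D (is_derive_dotl z w z)
  (is_derive1M (is_derive_id _ _) (is_derive_dotl z w w)))).
by rewrite lineZ0 (dot_sym w z); ring.
Qed.

Lemma is_derive_alpha z w : z != 0 ->
  is_derive (0 : R) 1 (fun t : R => alpha (z + t *: w)) (dot z w * rho z).
Proof.
move=> z0; have a0 := alpha_gt0 z0.
have p : 0 < dot (z + (0 : R) *: w) (z + (0 : R) *: w).
  by rewrite lineZ0 dot_pos.
apply: (is_derive_eq (is_derive1_comp (is_derive1_sqrt p)
  (is_derive_normsq z w))).
rewrite lineZ0 -/(alpha z) /rho.
by field; rewrite gt_eqF.
Qed.

Lemma is_derive_rho z w : z != 0 ->
  is_derive (0 : R) 1 (fun t : R => rho (z + t *: w)) (- (dot z w * rho z ^+ 3)).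
Proof.
move=> z0; have a0 := alpha_gt0 z0.
have p : alpha (z + (0 : R) *: w) != 0 by rewrite lineZ0 gt_eqF.
apply: (is_derive_eq (is_deriveV (f := fun t : R => alpha (z + t *: w)) p
  (is_derive_alpha w z0))).
rewrite lineZ0 /rho [LHS]mulNr.
by field; rewrite gt_eqF.
Qed.

Lemma is_derive_rnorm z w : z != 0 ->
  is_derive (0 : R) 1 (fun t : R => rnorm (z + t *: w)) (drnorm z w).
Proof.
move=> z0.
exact: (is_derive1D (is_derive_alpha w z0) (is_derive_dotr z w b)).
Qed.

Lemma is_derive_drnorm z w v : z != 0 ->
  is_derive (0 : R) 1 (fun t : R => drnorm (z + t *: w) v) (hess z w v).
Proof.
move=> z0.
apply: (is_derive_eq (is_derive1D
  (is_derive1M (is_derive_dotl z w v) (is_derive_rho w z0))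
  (is_derive_cst _ _ _))).
by rewrite lineZ0 /hess; ring.
Qed.

Lemma is_derive_hess z w u v : z != 0 ->
  is_derive (0 : R) 1 (fun t : R => hess (z + t *: w) u v) (dhess z w u v).
Proof.
move=> z0; have dr := is_derive_rho w z0.
apply: (is_derive_eq (is_derive1B
  (is_derive1M (is_derive_cst (dot u v) _ _) dr)
  (is_derive1M (is_derive1M (is_derive_dotl z w u) (is_derive_dotl z w v))
     (is_derive1M dr (is_derive1M dr dr))))).
by rewrite lineZ0 /dhess (dot_sym w u) /cst/=; ring.
Qed.

Lemma is_derive_gten z w u v : z != 0 ->
  is_derive (0 : R) 1 (fun t : R => gten (z + t *: w) u v) (2 * cten z w u v).
Proof.
move=> z0.
apply: (is_derive_eq (is_derive1D
  (is_derive1M (is_derive_rnorm w z0) (is_derive_hess w u v z0))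
  (is_derive1M (is_derive_drnorm w u z0) (is_derive_drnorm w v z0)))).
by rewrite lineZ0 /cten; field.
Qed.

(** The inner derivative in the fundamental tensor is known only at nonzero
    vectors, so the outer one has to be taken near 0. *)
Lemma near_line_neq0 (z w : V) : z != 0 -> \forall s \near (0 : R), z + s *: w != 0.
Proof.
move=> z0; have [/derivable1_diffP/differentiable_continuous c _] :=
  is_derive_normsq z w.
have : \forall s \near (0 : R), 0 < dot (z + s *: w) (z + s *: w).
  by apply: (cvgr_gt _ c); rewrite lineZ0 dot_pos.
apply: filterS => s; apply: contraTneq => ->.
by rewrite -(scale0r z) dotZl mul0r ltxx.
Qed.

Lemma derive1_rnorm_sqr (z v : V) : z != 0 ->
  derive1 (fun t : R => rnorm (z + t *: v) ^+ 2) 0 = 2 * rnorm z * drnorm z v.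
Proof.
move=> z0; have d := is_derive_rnorm v z0.
rewrite derive1E (@derive_val _ _ _ _ _ _ _ (is_derive1M d d)) lineZ0.
by ring.
Qed.

Lemma fundamental_tensorE (y u v : V) : y != 0 ->
  2^-1 * derive1 (fun s : R =>
    derive1 (fun t : R => rnorm (y + s *: u + t *: v) ^+ 2) 0) 0 = gten y u v.
Proof.
move=> y0; rewrite derive1E.
rewrite (@near_eq_derive _ _ _ _
  (fun s : R => 2 * rnorm (y + s *: u) * drnorm (y + s *: u) v)); last first.
  by near=> s; apply: derive1_rnorm_sqr; near: s; exact: near_line_neq0.
rewrite (@derive_val _ _ _ _ _ _ _ (is_derive1M (is_derive1M
  (is_derive_cst (2 : R) _ _) (is_derive_rnorm u y0)) (is_derive_drnorm u v y0))).
by rewrite lineZ0 /gten /cst/=; field.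
Unshelve. all: by end_near. Qed.

Lemma alphaE y : y != 0 -> alpha y = dot y y * rho y.
Proof. by move=> y0; rewrite -sqr_alpha expr2 -mulrA alphaV// mulr1. Qed.

Lemma normsqV y : y != 0 -> dot y y * rho y ^+ 2 = 1.
Proof. by move=> y0; rewrite -sqr_alpha -exprMn alphaV// expr1n. Qed.

Lemma drnorm_self y : y != 0 -> drnorm y y = rnorm y.
Proof. by move=> y0; rewrite /drnorm /rnorm -alphaE. Qed.

Lemma hessC y u v : hess y u v = hess y v u.
Proof. by rewrite /hess (dot_sym u v); ring. Qed.

(** Euler's relation: the differential of [alpha] is homogeneous of degree 0. *)
Lemma hess_self y v : y != 0 -> hess y y v = 0.
Proof.
move=> y0; rewrite /hess.
by transitivity (dot y v * rho y * (1 - dot y y * rho y ^+ 2));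
  [ring|rewrite normsqV// subrr mulr0].
Qed.

(** Euler's relation for [hess], which is homogeneous of degree -1: [dhess] is
    the third derivative of [alpha], hence symmetric in its last three
    arguments. *)
Lemma dhess_self y w v : y != 0 -> dhess y w y v = - hess y w v.
Proof.
move=> y0; rewrite /dhess /hess (dot_sym w y).
have n1 := normsqV y0.
(* Factors g(y, y) rho^2 = 1 are exhibited before they are replaced. *)
transitivity ((3 * (dot y y * rho y ^+ 2) - 2) * dot y v * dot y w * rho y ^+ 3
   - (dot y y * rho y ^+ 2) * dot w v * rho y); first by ring.
by rewrite n1; ring.
Qed.

Lemma gtenC y u v : gten y u v = gten y v u.
Proof. by rewrite /gten hessC mulrC [X in _ + X]mulrC [X in X + _]mulrC. Qed.

Lemma gtenDl y u v w : gten y (u + v) w = gten y u w + gten y v w.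
Proof. by rewrite /gten /hess /drnorm !(dotDl, dotDr); ring. Qed.

Lemma gtenNl y u w : gten y (- u) w = - gten y u w.
Proof. by rewrite /gten /hess /drnorm !(dotNl, dotNr); ring. Qed.

Lemma gten_self y v : y != 0 -> gten y y v = rnorm y * drnorm y v.
Proof. by move=> y0; rewrite /gten hess_self// mulr0 add0r drnorm_self. Qed.

Lemma cten_selfl y w v : y != 0 -> cten y w y v = 0.
Proof.
move=> y0.
by rewrite /cten (hessC y w y) !hess_self// dhess_self// drnorm_self//; ring.
Qed.

Lemma dot0 w : dot 0 w = 0.
Proof. by rewrite -(scale0r w) dotZl mul0r. Qed.

Lemma ctenDl y w1 w2 u v : cten y (w1 + w2) u v = cten y w1 u v + cten y w2 u v.
Proof.
rewrite /cten /hess /dhess /drnorm !(dotDl, dotDr); ring.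
Qed.

Lemma ctenNl y w u v : cten y (- w) u v = - cten y w u v.
Proof.
rewrite /cten /hess /dhess /drnorm !(dotNl, dotNr); ring.
Qed.

Lemma cten0 y u v : cten y 0 u v = 0.
Proof.
rewrite /cten /drnorm (hessC _ u) (hessC _ v) /hess /dhess.
by rewrite !(dot_sym _ 0) !dot0; ring.
Qed.

Lemma cauchy_schwarz u v : dot u v ^+ 2 <= dot u u * dot v v.
Proof.
have [->|v0] := eqVneq v 0; first by rewrite (dot_sym u 0) !dot0 mulr0 expr0n.
have vv := dot_pos v0.
(* This vector is g(v, v) times the component of u orthogonal to v. *)
have := dot_ge0 (dot v v *: u - dot u v *: v).
rewrite !(dotDl, dotDr, dotNl, dotNr, dotZl, dotZr) (dot_sym v u) => h.
rewrite -subr_ge0 -(pmulr_rge0 _ vv).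
by apply: le_trans h _; rewrite le_eqVlt; apply/orP; left; apply/eqP; ring.
Qed.

Hypothesis b_lt1 : alpha b < 1.

Lemma rnorm_gt0 y : y != 0 -> 0 < rnorm y.
Proof.
move=> y0; have a0 := alpha_gt0 y0.
have b0 : 0 <= alpha b by exact: sqrtr_ge0.
have lt : dot b y ^+ 2 < alpha y ^+ 2.
  apply: le_lt_trans (cauchy_schwarz b y) _.
  rewrite -!sqr_alpha -[ltRHS]mul1r ltr_pM2r ?exprn_gt0//.
  by rewrite expr_lt1.
have : `|dot b y| < alpha y.
  rewrite -(@ltr_pXn2r _ 2)// ?nnegrE ?normr_ge0 ?(ltW a0)//.
  by rewrite real_normK ?num_real.
by rewrite ltr_norml => /andP[+ _]; rewrite /rnorm; lra.
Qed.

(** With w the component of u orthogonal to y, the two terms of g_y(u, u) are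
    F rho g(w, w) and the square of dF_y(u).  If the first vanishes, u is a
    nonzero multiple of y and dF_y(u) is that multiple of F(y). *)
Lemma gten_gt0 y u : y != 0 -> u != 0 -> 0 < gten y u u.
Proof.
move=> y0 u0; have f0 := rnorm_gt0 y0; have n1 := normsqV y0.
have r0 : 0 < rho y by rewrite invr_gt0 alpha_gt0.
pose w := u - (dot y u * rho y ^+ 2) *: y.
have hw : hess y u u = rho y * dot w w.
  rewrite /hess /w !(dotDl, dotDr, dotNl, dotNr, dotZl, dotZr) (dot_sym u y).
  transitivity (rho y * dot u u - dot y u ^+ 2 * rho y ^+ 3 *
    (2 - dot y y * rho y ^+ 2)); last by ring.
  by rewrite n1; ring.
rewrite /gten hw.
have [w0|w0] := eqVneq w 0.
  have uE : u = (dot y u * rho y ^+ 2) *: y by apply/subr0_eq.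
  set c := dot y u * rho y ^+ 2 in uE.
  have c0 : c != 0 by apply: contraNneq u0 => c0; rewrite uE c0 scale0r.
  have -> : drnorm y u = c * rnorm y.
    by rewrite uE -drnorm_self// /drnorm !dotZr; ring.
  by rewrite w0 dot0 !mulr0 add0r -expr2 exprn_even_gt0//= mulf_neq0// gt_eqF.
apply: ltr_pwDl; last by rewrite -expr2 sqr_ge0.
by rewrite !mulr_gt0// dot_pos.
Qed.

(** The uniqueness of the Chern connection, in terms of the difference T of two
    solutions.  The reference vector v is eliminated first: C_v vanishes as
    soon as one of its arguments is v, so the equation with B = v, together
    with the symmetry of T, makes the form g_v(T(A, v), C) symmetric in A and
    C.  This gives T(v, v) = 0, then T(A, v) = 0.  The Cartan terms are now gone
    and the usual Koszul argument applies: g_v(T(A, B), C) is symmetric in A, B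
    and skew in B, C.  The type [K], here the vector fields, is mapped by [ev]
    to the tangent space; T(A, B) is itself in [K], so the vectors [ev C] are
    enough to test whether it vanishes, and no tangent vector has to be
    extended to a field. *)
Lemma almost_metric_difference_eq0 (K : Type) (ev : K -> V) (T : K -> K -> K)
    (v : K) :
  ev v != 0 -> (forall A B, ev (T A B) = ev (T B A)) ->
  (forall A B C, gten (ev v) (ev (T A B)) (ev C)
     + gten (ev v) (ev B) (ev (T A C))
     + 2 * cten (ev v) (ev (T A v)) (ev B) (ev C) = 0) ->
  forall A B, ev (T A B) = 0.
Proof.
move=> v0 Tsym H.
have nondeg Z : (forall C, gten (ev v) (ev Z) (ev C) = 0) -> ev Z = 0.
  move=> Z0; apply/eqP; apply: contraT => /(gten_gt0 v0).
  by rewrite Z0 ltxx.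
have Hv A C : gten (ev v) (ev (T A v)) (ev C)
    + gten (ev v) (ev v) (ev (T A C)) = 0.
  by have := H A v C; rewrite cten_selfl// mulr0 addr0.
have Hsym A C : gten (ev v) (ev (T A v)) (ev C)
    = gten (ev v) (ev (T C v)) (ev A).
  by have := Hv A C; have := Hv C A; rewrite (Tsym A C); lra.
have Tvv : ev (T v v) = 0.
  apply: nondeg => C; have := Hv v C; have := Hsym C v.
  by rewrite (Tsym v C) (gtenC _ (ev v) (ev (T C v))); lra.
have Tv A : ev (T A v) = 0.
  apply: nondeg => C; have := H v A C; have := Hsym A C.
  rewrite Tvv cten0 mulr0 addr0 (Tsym v A) (Tsym v C) (gtenC _ (ev A)); lra.
have skew A B C : gten (ev v) (ev (T A B)) (ev C)
    = - gten (ev v) (ev (T A C)) (ev B).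
  by have := H A B C; rewrite Tv cten0 (gtenC _ (ev B)); lra.
move=> A B; apply: nondeg => C.
have := skew A B C; have := skew C A B; have := skew B C A.
by rewrite (Tsym C A) (Tsym C B) (Tsym B A); lra.
Qed.

(** When the Gram determinant for [dot] is 0, so is the one for [gten]; both
    quotients are then 0 and the identity persists. *)
Lemma flag_ratio y u r : y != 0 -> dot r y = 0 -> dot r b = 0 ->
  gten y r u / (gten y y y * gten y u u - gten y y u ^+ 2) =
  (alpha y / rnorm y) ^+ 2 * (dot r u / (dot y y * dot u u - dot y u ^+ 2)).
Proof.
move=> y0 ry rb; have f0 := rnorm_gt0 y0; have a0 := alpha_gt0 y0.
have -> : gten y r u = rnorm y / alpha y * dot r u.
  by rewrite /gten /hess /drnorm (dot_sym y r) (dot_sym b r) ry rb /rho; ring.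
have -> : gten y y y * gten y u u - gten y y u ^+ 2 =
    (rnorm y / alpha y) ^+ 3 * (dot y y * dot u u - dot y u ^+ 2).
  rewrite !gten_self// drnorm_self// /gten /hess /rho -[dot y y]sqr_alpha.
  by field; rewrite gt_eqF.
rewrite invfM mulrACA; congr (_ * _).
by field; rewrite !gt_eqF.
Qed.

End MinkowskiNorm.

(** * Smoothness of the reciprocal square root *)

(** The function r = f^(-1/2) satisfies D_v r = - 1/2 r^3 D_v f, whose right
    side contains no new function, so an induction on the order of
    differentiability closes on r alone. *)
Lemma Ck_inv_sqrt (R : realType) (V : normedModType R) (U : set V) k
    (f : V -> R) : open U -> (forall x, 0 < f x) ->
  Ck U k f -> Ck U k (fun x => (Num.sqrt (f x))^-1).
Proof.
move=> oU f0; elim: k => [|k IH] Cf.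
  move=> x Ux; apply: cvgV; first by rewrite gt_eqF// sqrtr_gt0.
  have c : f y @[y --> x] --> f x := Cf x Ux.
  exact: (cvg_comp _ _ c (@sqrt_continuous R (f x))).
have Cr := IH (CkW Cf); have [df Df] := Cf.
pose h (y : R) : R := (Num.sqrt y)^-1.
pose r (x : V) : R := (Num.sqrt (f x))^-1.
have dh x : is_derive (f x) 1 h (- 2^-1 * r x ^+ 3).
  have s0 : Num.sqrt (f x) != 0 by rewrite gt_eqF// sqrtr_gt0.
  apply: (is_derive_eq (is_deriveV (f := @Num.sqrt R) s0
    (is_derive1_sqrt (f0 x)))).
  by rewrite /r [LHS]mulNr; field.
have dfh x : differentiable h (f x) by apply/derivable1_diffP; case: (dh x).
split=> [x Ux|v]; first by apply: (differentiable_comp (df x Ux) (dfh x)).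
have Cr3 := CkM oU (Ck_cst oU k (- 2^-1)) (CkM oU Cr (CkM oU Cr Cr)).
apply: Ck_ext (CkM oU Cr3 (Df v)) => // x Ux.
rewrite (_ : (fun x => _) = h \o f)//.
rewrite (deriveE _ (differentiable_comp (df x Ux) (dfh x))).
rewrite diff_comp//; last exact: df.
rewrite /= diff1E// derive1E (@derive_val _ _ _ _ _ _ _ (dh x)).
rewrite -(deriveE _ (df x Ux)) /r.
by rewrite /GRing.scale/= !fctE -/(h (f x)); ring.
Qed.

(** * Vector fields, metric and curvature *)

Section Fields.
Variables (R : realType) (n : nat) (M : topologicalType).
Variable S : smooth_manifold R n M.
Implicit Types (A B C W Y Z : vfield S) (f h : Cinf S).

Lemma smooth_inv_sqrt f : (forall p, 0 < f p) ->
  exists r : Cinf S, forall p, r p = (Num.sqrt (f p))^-1.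
Proof.
move=> f0.
have sr : (fun p => (Num.sqrt (f p))^-1) \in smooth_pred S.
  apply/asboolP => c cS k.
  apply: (@Ck_inv_sqrt _ _ _ k (f \o chart_inv c)).
  - exact: chart_img_open cS.
  - by move=> x; exact: f0.
  have /asboolP sf : Cinf_val f \in smooth_pred S := valP f.
  exact: (sf c cS k).
by exists (MkCinf sr).
Qed.

Lemma vfield_atD A B p : vfield_at (A + B) p = vfield_at A p + vfield_at B p.
Proof. exact/val_inj. Qed.

Lemma vfield_atN A p : vfield_at (- A) p = - vfield_at A p.
Proof. exact/val_inj. Qed.

Lemma vfield_at0 p : vfield_at (0 : vfield S) p = 0.
Proof. exact/val_inj. Qed.

Lemma vfield_ext A B : (forall p, vfield_at A p = vfield_at B p) -> A = B.
Proof.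
move=> AB; apply/val_inj/funext => f; apply: Cinf_ext => p.
exact: (congr1 (fun t : tangent S p => t f) (AB p)).
Qed.

Lemma deriv_linear W (a : R) f h : W (a *: f + h) = a *: W f + W h.
Proof.
by have /asboolP[lW _] : vfield_val W \in @vfield_pred _ _ _ S := valP W.
Qed.

Lemma derivM W f h : W (f * h) = f * W h + h * W f.
Proof.
by have /asboolP[_ LW] : vfield_val W \in @vfield_pred _ _ _ S := valP W.
Qed.

Lemma derivD W f h : W (f + h) = W f + W h.
Proof. by rewrite -[f]scale1r deriv_linear !scale1r. Qed.

Lemma derivN W f : W (- f) = - W f.
Proof.
have W0 : W 0 = 0 by apply: (addrI (W 0)); rewrite -derivD !addr0.
by apply/eqP; rewrite -addr_eq0 -derivD addNr W0.
Qed.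

Lemma deriv1 W : W 1 = 0.
Proof.
by apply: (addrI (W 1)); rewrite addr0 -[in RHS](mul1r 1) derivM !mul1r.
Qed.

Variable g : riemannian_metric S.

Lemma metric_inner p : inner_product (g p).
Proof.
by split; [exact: metric_linear|exact: Defs.metric_sym|exact: metric_pos].
Qed.

(** The norm and the inverse norm of a nowhere zero field are elements of
    C^oo(M), to which vector fields can be applied. *)
Lemma metric_sqrt A : (forall p, vfield_at A p != 0) ->
  exists a r : Cinf S, forall p,
    a p = alpha (g p) (vfield_at A p) /\ r p = rho (g p) (vfield_at A p).
Proof.
move=> A0.
have [p|r rE] := @smooth_inv_sqrt (metric_fun g A A).
  exact: metric_pos.
exists (metric_fun g A A * r), r => p; split; last exact: rE.
by rewrite CinfM rE (alphaE (metric_inner p) (A0 p)).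
Qed.

Lemma metric_funC A B : metric_fun g A B = metric_fun g B A.
Proof. by apply: Cinf_ext => p; exact: Defs.metric_sym. Qed.

Lemma metric_funDl A B C :
  metric_fun g (A + B) C = metric_fun g A C + metric_fun g B C.
Proof.
apply: Cinf_ext => p; rewrite CinfD /= vfield_atD.
exact: (dotDl (metric_inner p)).
Qed.

Lemma metric_funNl A C : metric_fun g (- A) C = - metric_fun g A C.
Proof.
apply: Cinf_ext => p; rewrite CinfN /= vfield_atN.
exact: (dotNl (metric_inner p)).
Qed.

Lemma metric_fun0l C : metric_fun g 0 C = 0.
Proof.
apply: Cinf_ext => p; rewrite /= vfield_at0.
exact: (dot0 (metric_inner p)).
Qed.

Variable nabla : vfield S -> vfield S -> vfield S.
Hypothesis nabla_LC : levi_civita g nabla.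

(** Apply both sides of [A, B] = AB - BA to the function g(Y, Z) and use
    metric compatibility. *)
Lemma curvature_skew A B Y Z :
  metric_fun g (curvature nabla A B Y) Z
  = - metric_fun g (curvature nabla A B Z) Y.
Proof.
have [_ _ compat] := nabla_LC.
have : lie_bracket A B (metric_fun g Y Z)
  = A (B (metric_fun g Y Z)) - B (A (metric_fun g Y Z)) by [].
rewrite !compat !derivD !compat /curvature !(metric_funDl, metric_funNl).
rewrite (metric_funC Y (nabla A (nabla B Z))).
rewrite (metric_funC Y (nabla B (nabla A Z))).
rewrite (metric_funC Y (nabla _ Z)) => /eqP; rewrite -subr_eq0 => /eqP e.
apply/eqP; rewrite -subr_eq0; apply/eqP; rewrite -[RHS]oppr0 -e.
by ring.
Qed.

(** * The Chern connection of a Randers metric of Berwald type *)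

Variable X : vfield S.
Hypothesis X_parallel : parallel nabla X.

Lemma curvature_parallel A B Y : metric_fun g (curvature nabla A B Y) X = 0.
Proof.
have nabla0 C : nabla C 0 = 0.
  have [[_ addn _] _ _] := nabla_LC.
  by apply: (addrI (nabla C 0)); rewrite -addn !addr0.
rewrite curvature_skew /curvature !X_parallel !nabla0 !subr0 metric_fun0l.
by rewrite oppr0.
Qed.

Local Notation G p := (gten (g p) (vfield_at X p)).
Local Notation C3 p := (cten (g p) (vfield_at X p)).

(** The defining equations of the Chern connection hold for nabla.  The field
    derivatives of alpha(V) and 1 / alpha(V) are obtained from the relations
    alpha * alpha = g(V, V) and alpha * (1 / alpha) = 1 in C^oo(M), so that no
    chain rule on the manifold is needed; each is the derivative along a line
    in the direction nabla_W V, as in the Cartan tensor. *)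
Lemma levi_civita_almost_metric V Y Z : nowhere_zero V ->
  exists2 h : Cinf S,
    forall p, h p = G p (vfield_at V p) (vfield_at Y p) (vfield_at Z p) &
    forall W p, W h p =
      G p (vfield_at V p) (vfield_at (nabla W Y) p) (vfield_at Z p) +
      G p (vfield_at V p) (vfield_at Y p) (vfield_at (nabla W Z) p) +
      2 * C3 p (vfield_at V p) (vfield_at (nabla W V) p) (vfield_at Y p)
                                                        (vfield_at Z p).
Proof.
move=> V0; have [_ _ compat] := nabla_LC.
have [a [r ar]] := metric_sqrt V0.
pose m := metric_fun g.
have Wm W A : W (m X A) = m X (nabla W A).
  by rewrite compat X_parallel metric_fun0l add0r.
have ra : r * a = 1.
  apply: Cinf_ext => p; rewrite CinfM; have [-> ->] := ar p.
  by rewrite mulrC (alphaV (metric_inner p) (V0 p)).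
have aa : a * a = m V V.
  apply: Cinf_ext => p; rewrite CinfM; have [-> _] := ar p.
  by rewrite -expr2 (sqr_alpha (metric_inner p)).
have Wa W : W a = m V (nabla W V) * r.
  have := congr1 W aa; rewrite derivM compat (metric_funC _ V) => e.
  have e2 : (r * a) * W a *+ 2 = m V (nabla W V) * r *+ 2.
    transitivity ((m V (nabla W V) + m V (nabla W V)) * r); last by ring.
    by rewrite -[_ + _ in RHS]e; ring.
  apply: Cinf_ext => p; move: (congr1 (fun h : Cinf S => h p) e2).
  rewrite ra mul1r !mulr2n !CinfD; lra.
have Wr W : W r = - (m V (nabla W V) * (r * (r * r))).
  have := congr1 W ra; rewrite derivM deriv1 Wa => e.
  rewrite -[LHS]mul1r -ra; apply/eqP; rewrite -subr_eq0; apply/eqP.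
  by rewrite -[RHS](mulr0 r) -e; ring.
exists ((a + m X V) * (m Y Z * r - m V Y * m V Z * (r * (r * r)))
        + (m V Y * r + m X Y) * (m V Z * r + m X Z)) => [p|W p].
  by rewrite !CinfE; have [-> ->] := ar p; rewrite /gten /hess !exprS expr0 mulr1.
rewrite !(derivD, derivN, derivM, Wa, Wr, Wm) /m !compat.
rewrite !CinfE; have [-> ->] := ar p.
rewrite /cten /gten /rnorm /hess /dhess /drnorm /=.
rewrite -/(metric_val g) (Defs.metric_sym g (vfield_at (nabla W V) p) _).
by field.
Qed.

Lemma fundamental_tensor_randers p (y u v : tangent S p) : y != 0 ->
  fundamental_tensor (randers g X) y u v = G p y u v.
Proof. by move=> y0; exact: (fundamental_tensorE (metric_inner p)). Qed.

Lemma cartan_tensor_randers p (y w u v : tangent S p) : y != 0 ->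
  cartan_tensor (randers g X) y w u v = C3 p y w u v.
Proof.
move=> y0; rewrite /cartan_tensor derive1E.
rewrite (@near_eq_derive _ _ _ _ (fun t : R => G p (y + t *: w) u v)).
  rewrite (@derive_val _ _ _ _ _ _ _
    (is_derive_gten (metric_inner p) (vfield_at X p) w u v y0)).
  by rewrite mulKf// pnatr_eq0.
near=> t; apply: fundamental_tensor_randers; near: t.
exact: (near_line_neq0 (metric_inner p)).
Unshelve. all: by end_near. Qed.

Hypothesis X_lt1 :
  forall p, Num.sqrt (g p (vfield_at X p) (vfield_at X p)) < 1.
Variable D : vfield S -> vfield S -> vfield S -> vfield S.
Hypothesis D_chern : chern_connection (randers g X) D.

Lemma chern_eq_levi_civita V A B : nowhere_zero V -> D V A B = nabla A B.
Proof.
move=> V0; have [_ tfD acD] := D_chern V0.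
have [_ tfn _] := nabla_LC.
pose T A B := D V A B - nabla A B.
have TE p A' B' : vfield_at (T A' B') p =
    vfield_at (D V A' B') p - vfield_at (nabla A' B') p.
  by rewrite vfield_atD vfield_atN.
apply: vfield_ext => p; apply: subr0_eq; rewrite -TE.
apply: (@almost_metric_difference_eq0 _ _ _ (metric_inner p) _ (X_lt1 p)
  _ (fun Z : vfield S => vfield_at Z p) T V) => [|A' B'|W Y Z].
- exact: V0.
- congr (vfield_at _ p); rewrite /T -[D V A' B'](subrK (D V B' A')) tfD.
  by rewrite -[nabla A' B'](subrK (nabla B' A')) tfn opprD addrACA subrr add0r.
have [h hE dh] := levi_civita_almost_metric Y Z V0.
have hF q : h q = fundamental_tensor (randers g X) (vfield_at V q)
    (vfield_at Y q) (vfield_at Z q).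
  by rewrite hE fundamental_tensor_randers//; exact: V0.
have := acD W Y Z h hF p; rewrite dh.
rewrite !fundamental_tensor_randers ?cartan_tensor_randers; do ?exact: V0.
move=> e.
rewrite !TE.
have ip := metric_inner p.
move: e; set x := vfield_at X p; set v := vfield_at V p.
rewrite !(gtenC ip x v (vfield_at Y p)) !(gtenDl ip) !(gtenNl ip).
rewrite (ctenDl ip) (ctenNl ip); lra.
Qed.

(** Both curvatures come from the same vector R(U, Y)Y; skew-symmetry and the
    parallel field X make it orthogonal to Y and to X, as [flag_ratio] asks. *)
Lemma flag_curvature_randers p U Y : nowhere_zero Y ->
  flag_curvature (randers g X) D p U Y =
  (alpha (g p) (vfield_at Y p) / randers g X (vfield_at Y p)) ^+ 2 *
  sectional_curvature g nabla p U Y.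
Proof.
move=> Y0; rewrite /flag_curvature !fundamental_tensor_randers; do ?exact: Y0.
have -> : D Y = nabla.
  by apply/funext => A; apply/funext => B; exact: chern_eq_levi_civita.
apply: (flag_ratio (metric_inner p) (X_lt1 p)); first exact: Y0.
  have := congr1 (fun f : Cinf S => f p) (curvature_skew U Y Y Y).
  by rewrite CinfN /=; lra.
exact: (congr1 (fun f : Cinf S => f p) (curvature_parallel U Y Y)).
Qed.

End Fields.

Theorem mainTheorem6 (R : realType) (N : topGroupType)
  (S : smooth_manifold R 5 N)
  (N_lie : lie_group S) (N_sc : simply_connected R N)
  (N_2step : two_step_nilpotent S)
  (N_center : has_dim (lie_center S) 3)
  (g : riemannian_metric S) (g_inv : left_invariant_metric g)
  (nabla : vfield S -> vfield S -> vfield S)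
  (nabla_LC : levi_civita g nabla)
  (F : forall p : N, tangent S p -> R) (X : vfield S)
  (X_lt1 : forall p, Num.sqrt (g p (vfield_at X p) (vfield_at X p)) < 1)
  (F_randers : forall p (y : tangent S p), F p y = randers g X y)
  (F_inv : left_invariant_finsler F)
  (F_berwald : parallel nabla X)
  (D : vfield S -> vfield S -> vfield S -> vfield S)
  (D_chern : chern_connection F D)
  (P : set (tangent S 1%g)) (P_dim : has_dim P 2)
  (A : tangent S 1%g) (A_P : P A) (A_neq0 : A != 0)
  (U Y : vfield S) (Y_neq0 : nowhere_zero Y) (Y_A : vfield_at Y 1%g = A)
  (UY_P : P = [set s *: vfield_at U 1%g + t *: A | s in [set: R] & t in [set: R]]) :
  (0 < flag_curvature F D 1%g U Y <-> 0 < sectional_curvature g nabla 1%g U Y) /\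
  (flag_curvature F D 1%g U Y = 0 <-> sectional_curvature g nabla 1%g U Y = 0) /\
  (flag_curvature F D 1%g U Y < 0 <-> sectional_curvature g nabla 1%g U Y < 0).
Proof.
have FE : F = @randers _ _ _ S g X by apply: functional_extensionality_dep => p;
  apply/funext => y; exact: F_randers.
rewrite FE in D_chern *.
rewrite (flag_curvature_randers nabla_LC F_berwald X_lt1 D_chern)//.
set c := _ ^+ 2.
have c0 : 0 < c.
  rewrite exprn_gt0// divr_gt0//.
    by apply: (alpha_gt0 (metric_inner g 1%g)); exact: Y_neq0.
  by apply: (rnorm_gt0 (metric_inner g 1%g) (X_lt1 1%g)); exact: Y_neq0.
rewrite pmulr_rgt0// pmulr_rlt0//; split=> //; split=> //; split.
  by move/eqP; rewrite mulf_eq0 gt_eqF//= => /eqP.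
by move=> ->; rewrite mulr0.
Qed.
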